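(* The indefinite octonionic projective plane $\mathbb OP^{(1,1)}$ with the semi-Riemannian metric $g$ below is homogeneous, i.e. its isometry group acts transitively.
   Context: Octonions $\mathbb O=\mathbb H\oplus\mathbb H$ with product $(q_1,q_2)(p_1,p_2)=(q_1p_1-\bar p_2q_2,\ p_2q_1+q_2\bar p_1)$, conjugation $\overline{(q_1,q_2)}=(\bar q_1,-q_2)$, $\langle a,b\rangle=\mathrm{Re}(a\bar b)$, $|a|^2=\langle a,a\rangle$. $\mathbb OP^{(1,1)}=(U_1\cup U_2)/_\sim$ with $U_1=\{(1,u,v):1+|u|^2-|v|^2>0\}$, $U_2=\{(u,1,v):|u|^2+1-|v|^2>0\}$ and $[a,b,c]\sim[d,e,f]$ iff $(a,b,c)=(d\lambda,e\lambda,f\lambda)$ for some $\lambda\in\mathbb O\setminus\{0\}$; charts $[1,u,v]\mapsto(u,v)$, $[u,1,v]\mapsto(u,v)$. The metric $g$ (of signature $(8,8)$) on each chart, for tangent vector $(du,dv)=(\xi,\eta)$: $ds^2=\frac{|\xi|^2(1-|v|^2)-|\eta|^2(1+|u|^2)+2\mathrm{Re}[(u\bar v)(\eta\bar\xi)]}{(1+|u|^2-|v|^2)^2}$. *)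

(* Defs.v *)
From HB Require Import structures.
From mathcomp Require Import all_boot all_order all_algebra.
From mathcomp Require Import all_classical all_reals all_analysis.
From Stdlib Require Import Relation_Operators.
Set Implicit Arguments. Unset Strict Implicit. Unset Printing Implicit Defensive.
Import Order.TTheory GRing.Theory Num.Theory.
Import numFieldNormedType.Exports.
Local Open Scope ring_scope.

Section Octonions.
Variable R : realType.

(** Quaternions H = R^4, components (a, b, c, d) = a + b i + c j + d k. *)
Definition quat := 'rV[R]_4.
Definition qc (q : quat) (n : nat) : R := q ord0 (inord n).
Definition mkq (a b c d : R) : quat := \row_(i < 4) nth 0 [:: a; b; c; d] i.

Definition qmul (q p : quat) : quat :=
  let a1 := qc q 0 in let b1 := qc q 1 in let c1 := qc q 2 in let d1 := qc q 3 in
  let a2 := qc p 0 in let b2 := qc p 1 in let c2 := qc p 2 in let d2 := qc p 3 in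
  mkq (a1*a2 - b1*b2 - c1*c2 - d1*d2)
      (a1*b2 + b1*a2 + c1*d2 - d1*c2)
      (a1*c2 - b1*d2 + c1*a2 + d1*b2)
      (a1*d2 + b1*c2 - c1*b2 + d1*a2).
Definition qconj (q : quat) : quat := mkq (qc q 0) (- qc q 1) (- qc q 2) (- qc q 3).
Definition qone : quat := mkq 1 0 0 0.

(** Octonions O = H (+) H (Cayley--Dickson, convention of the paper). *)
Definition oct := (quat * quat)%type.
Definition omul (x y : oct) : oct :=
  (qmul x.1 y.1 - qmul (qconj y.2) x.2, qmul y.2 x.1 + qmul x.2 (qconj y.1)).
Definition oconj (x : oct) : oct := (qconj x.1, - x.2).
Definition oone : oct := (qone, 0).
Definition ore (x : oct) : R := qc x.1 0.
Definition oinner (a b : oct) : R := ore (omul a (oconj b)).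
Definition onorm2 (a : oct) : R := oinner a a.

Definition triple := (oct * oct * oct)%type.
Definition inU1 (t : triple) : Prop :=
  let: (a, u, v) := t in a = oone /\ 0 < 1 + onorm2 u - onorm2 v.
Definition inU2 (t : triple) : Prop :=
  let: (u, b, v) := t in b = oone /\ 0 < onorm2 u + 1 - onorm2 v.
Definition inU (t : triple) : Prop := inU1 t \/ inU2 t.

(** [a,b,c] ~ [d,e,f] iff (a,b,c) = (d l, e l, f l) for some l <> 0;
    points of OP^(1,1) are classes of elements of U1 \cup U2 for the
    equivalence relation generated by ~ . *)
Definition osim (t s : triple) : Prop :=
  let: (a, b, c) := t in let: (d, e, f) := s in
  exists l : oct, l <> 0 /\ a = omul d l /\ b = omul e l /\ c = omul f l.
Definition Msim (t s : triple) : Prop :=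
  clos_refl_sym_trans triple (fun x y => inU x /\ inU y /\ osim x y) t s.

Definition coord := (oct * oct)%type.
Definition cdom (x : coord) : Prop := 0 < 1 + onorm2 x.1 - onorm2 x.2.
Definition cemb (i : bool) (x : coord) : triple :=
  if i then (oone, x.1, x.2) else (x.1, oone, x.2).

(** The metric g in a chart: ds^2 at (u,v) on the tangent vector (xi,eta). *)
Definition gmet (x : coord) (w : coord) : R :=
  let: (u, v) := x in let: (xi, eta) := w in
  (onorm2 xi * (1 - onorm2 v) - onorm2 eta * (1 + onorm2 u)
    + 2 * ore (omul (omul u (oconj v)) (omul eta (oconj xi))))
  / (1 + onorm2 u - onorm2 v) ^+ 2.

Definition iterD (vs : seq coord) (f : coord -> coord) : coord -> coord :=
  foldr (fun w g => fun x => 'D_w g x) f vs.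
Definition smooth_on (D : set coord) (f : coord -> coord) : Prop :=
  forall (vs : seq coord) (x : coord), D x ->
    {for x, continuous (iterD vs f)} /\ forall w, derivable (iterD vs f) x w.

(** Maps of OP^(1,1), given on representatives. *)
Definition Mmap (F : triple -> triple) : Prop :=
  (forall t, inU t -> inU (F t)) /\
  (forall t s, inU t -> inU s -> Msim t s -> Msim (F t) (F s)).

Definition locdom (F : triple -> triple) (i j : bool) (x : coord) : Prop :=
  cdom x /\ exists y, cdom y /\ Msim (cemb j y) (F (cemb i x)).

Definition smooth_map (F : triple -> triple) : Prop :=
  Mmap F /\ forall i j : bool, open (locdom F i j) /\
  exists f : coord -> coord,
    (forall x, locdom F i j x -> cdom (f x) /\ Msim (cemb j (f x)) (F (cemb i x)))
    /\ smooth_on (locdom F i j) f.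

Definition preserves_metric (F : triple -> triple) : Prop :=
  forall (i j : bool) (f : coord -> coord),
    (forall x, locdom F i j x -> cdom (f x) /\ Msim (cemb j (f x)) (F (cemb i x))) ->
    forall x, locdom F i j x -> forall w : coord, gmet (f x) ('D_w f x) = gmet x w.

Definition OP11_isometry (F : triple -> triple) : Prop :=
  smooth_map F /\ preserves_metric F /\
  exists G : triple -> triple, smooth_map G /\
    (forall t, inU t -> Msim (G (F t)) t) /\ (forall t, inU t -> Msim (F (G t)) t).

End Octonions.

(* Main.v *)
Require Import Defs.
From HB Require Import structures.
From mathcomp Require Import all_boot all_order all_algebra.
From mathcomp Require Import all_classical all_reals all_analysis.
From mathcomp Require Import ring.
Import Defs.
Set Implicit Arguments. Unset Strict Implicit. Unset Printing Implicit Defensive.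
Import Order.TTheory GRing.Theory Num.Theory.
Import numFieldNormedType.Exports.
Local Open Scope classical_set_scope.
Local Open Scope ring_scope.

(* Send [x, y, z] to the rank one Hermitian matrix with entries
   |x|^2, |y|^2, |z|^2, x y^*, x z^*, y z^*, divided by |x|^2 + |y|^2 - |z|^2.
   This identifies OP^(1,1) with a subset of the 27-dimensional space of
   Hermitian octonionic matrices, and in a chart the quantity 1 - <P, Q>, for the
   invariant form <_, _>, equals c(x)/c(y) times the metric at x on y - x, where
   c = 1 + |u|^2 - |v|^2. Hence any rational map of matrices that preserves the
   subset and the form induces an isometry. Three families of such maps suffice:
   (u, v) |-> (a^* u, a v) for a unit octonion a (by the Moufang identities),
   real rotations of (x, y), and real boosts of (x, z). Starting from [1, u, v],
   the first family makes u real, a rotation kills u, the first family makes v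
   real, and a boost kills v. *)

(** * Octonion identities checked in real coordinates *)

Section Algebra.
Variable R : realType.
Implicit Types (a b c d k : R) (x y z : oct R).

Lemma qc_mkq a b c d :
  (qc (mkq a b c d) 0 = a) * (qc (mkq a b c d) 1 = b) *
  (qc (mkq a b c d) 2 = c) * (qc (mkq a b c d) 3 = d).
Proof. by rewrite /qc /mkq !mxE !inordK. Qed.

Lemma mkq_eta (q : quat R) : q = mkq (qc q 0) (qc q 1) (qc q 2) (qc q 3).
Proof.
apply/rowP => i; rewrite !mxE /qc.
by case: i => -[|[|[|[|//]]]] ? /=; congr (q _ _); apply/val_inj; rewrite /= inordK.
Qed.

Lemma mkqD a b c d a' b' c' d' :
  mkq a b c d + mkq a' b' c' d' = mkq (a + a') (b + b') (c + c') (d + d').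
Proof. by apply/rowP => i; rewrite !mxE; case: i => -[|[|[|[|//]]]] ?. Qed.

Lemma mkqN a b c d : - mkq a b c d = mkq (- a) (- b) (- c) (- d).
Proof. by apply/rowP => i; rewrite !mxE; case: i => -[|[|[|[|//]]]] ?. Qed.

Lemma mkqZ k a b c d : k *: mkq a b c d = mkq (k * a) (k * b) (k * c) (k * d).
Proof. by apply/rowP => i; rewrite !mxE; case: i => -[|[|[|[|//]]]] ?. Qed.

Lemma mkq0 : 0 = mkq 0 0 0 0 :> quat R.
Proof. by apply/rowP => i; rewrite !mxE; case: i => -[|[|[|[|//]]]] ?. Qed.

Lemma qmul_mkq a b c d a' b' c' d' :
  qmul (mkq a b c d) (mkq a' b' c' d') =
  mkq (a*a' - b*b' - c*c' - d*d') (a*b' + b*a' + c*d' - d*c')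
      (a*c' - b*d' + c*a' + d*b') (a*d' + b*c' - c*b' + d*a').
Proof. by rewrite /qmul !qc_mkq. Qed.

Lemma qconj_mkq a b c d : qconj (mkq a b c d) = mkq a (- b) (- c) (- d).
Proof. by rewrite /qconj !qc_mkq. Qed.

(** Exposes the eight real coordinates of an octonion, so that an octonion identity becomes
    polynomial identities for [ring]. *)
Lemma oct_rect (P : oct R -> Type) :
  (forall a b c d a' b' c' d', P (mkq a b c d, mkq a' b' c' d')) -> forall x, P x.
Proof. by move=> H [q r]; rewrite (mkq_eta q) (mkq_eta r). Qed.

Lemma octD (p q p' q' : quat R) : ((p, q) : oct R) + (p', q') = (p + p', q + q').
Proof. by []. Qed.
Lemma octN (p q : quat R) : - ((p, q) : oct R) = (- p, - q).
Proof. by []. Qed.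
Lemma octZ k (p q : quat R) : k *: ((p, q) : oct R) = (k *: p, k *: q).
Proof. by []. Qed.
Lemma oct0 : 0 = (0, 0) :> oct R.
Proof. by []. Qed.

Ltac octcalc :=
  rewrite /onorm2 /oinner /ore /oone /qone /omul /oconj /=
    ?(oct0, octD, octN, octZ) /= ?mkq0
    ?(qmul_mkq, qconj_mkq, mkqD, mkqN, mkqZ, qc_mkq).
Ltac octring :=
  octcalc; first [ring | congr pair; congr mkq; ring].


Ltac octvar x := elim/oct_rect: x => ? ? ? ? ? ? ? ?.

Lemma omulDl x y z : omul (x + y) z = omul x z + omul y z.
Proof. by octvar x; octvar y; octvar z; octring. Qed.

Lemma omulDr x y z : omul x (y + z) = omul x y + omul x z.
Proof. by octvar x; octvar y; octvar z; octring. Qed.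

Lemma omulZl k x y : omul (k *: x) y = k *: omul x y.
Proof. by octvar x; octvar y; octring. Qed.

Lemma omulZr k x y : omul x (k *: y) = k *: omul x y.
Proof. by octvar x; octvar y; octring. Qed.

Lemma omul1o x : omul (oone R) x = x.
Proof. by octvar x; octring. Qed.

Lemma omulo1 x : omul x (oone R) = x.
Proof. by octvar x; octring. Qed.

Lemma omulo0 x : omul x 0 = 0.
Proof. by octvar x; octring. Qed.

Lemma oconjD x y : oconj (x + y) = oconj x + oconj y.
Proof. by octvar x; octvar y; octring. Qed.

Lemma oconjZ k x : oconj (k *: x) = k *: oconj x.
Proof. by octvar x; octring. Qed.

Lemma oconjK x : oconj (oconj x) = x.
Proof. by octvar x; octring. Qed.

Lemma oconjM x y : oconj (omul x y) = omul (oconj y) (oconj x).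
Proof. by octvar x; octvar y; octring. Qed.

Lemma oconj1 : oconj (oone R) = oone R.
Proof. by octring. Qed.

Lemma omul_conj x : omul x (oconj x) = onorm2 x *: oone R.
Proof. by octvar x; octring. Qed.

Lemma omul_conjl x : omul (oconj x) x = onorm2 x *: oone R.
Proof. by octvar x; octring. Qed.

Lemma onorm2M x y : onorm2 (omul x y) = onorm2 x * onorm2 y.
Proof. by octvar x; octvar y; octring. Qed.

Lemma onorm2Z k x : onorm2 (k *: x) = k ^+ 2 * onorm2 x.
Proof. by octvar x; octring. Qed.

Lemma onorm2_conj x : onorm2 (oconj x) = onorm2 x.
Proof. by octvar x; octring. Qed.

Lemma onorm2_1 : onorm2 (oone R) = 1.
Proof. by octring. Qed.

Lemma onorm2_0 : onorm2 (0 : oct R) = 0.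
Proof. by octring. Qed.

Lemma onorm2_mkq a b c d a' b' c' d' :
  onorm2 (mkq a b c d, mkq a' b' c' d') =
  a^+2 + b^+2 + c^+2 + d^+2 + (a'^+2 + b'^+2 + c'^+2 + d'^+2).
Proof. by octring. Qed.

Lemma onorm2_ge0 x : 0 <= onorm2 x.
Proof. by octvar x; rewrite onorm2_mkq !addr_ge0 ?sqr_ge0. Qed.

Lemma onorm2_eq0 x : onorm2 x = 0 -> x = 0.
Proof.
octvar x; rewrite onorm2_mkq => /eqP.
rewrite !paddr_eq0 ?addr_ge0 ?sqr_ge0 // !sqrf_eq0.
case/andP=> /andP[/andP[/andP[/eqP-> /eqP->] /eqP->] /eqP->].
by case/andP=> /andP[/andP[/eqP-> /eqP->] /eqP->] /eqP->; rewrite -mkq0.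
Qed.

Lemma onorm2_neq0 x : x <> 0 -> onorm2 x != 0.
Proof. by move=> x0; apply/eqP => /onorm2_eq0. Qed.

Lemma omulVK x y : omul (omul x (oconj y)) y = onorm2 y *: x.
Proof. by octvar x; octvar y; octring. Qed.

Lemma omulKV x y : omul (omul x y) (oconj y) = onorm2 y *: x.
Proof. by octvar x; octvar y; octring. Qed.

Lemma omulVKl x y : omul (oconj y) (omul y x) = onorm2 y *: x.
Proof. by octvar x; octvar y; octring. Qed.

Lemma omulKVl x y : omul y (omul (oconj y) x) = onorm2 y *: x.
Proof. by octvar x; octvar y; octring. Qed.

Lemma moufang_mid x y z :
  omul (omul x y) (omul z x) = omul x (omul (omul y z) x).
Proof. by octvar x; octvar y; octvar z; octring. Qed.

(** The right Moufang identity ((a b) c) b = a (b (c b)) at a = x y, b = \bar y, c = z, where (x y)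
    \bar y collapses to |y|^2 x. *)
Lemma moufang_right x y z :
  omul (omul x y) (omul (oconj y) (omul z (oconj y)))
  = onorm2 y *: omul (omul x z) (oconj y).
Proof. by octvar x; octvar y; octvar z; octring. Qed.

Lemma oinnerC x y : oinner x y = oinner y x.
Proof. by octvar x; octvar y; octring. Qed.

Lemma oinnerxx x : oinner x x = onorm2 x.
Proof. by []. Qed.

Lemma oinnerDl x y z : oinner (x + y) z = oinner x z + oinner y z.
Proof. by octvar x; octvar y; octvar z; octring. Qed.

Lemma oinnerDr x y z : oinner z (x + y) = oinner z x + oinner z y.
Proof. by rewrite oinnerC oinnerDl !(oinnerC z). Qed.

Lemma oinnerZl k x y : oinner (k *: x) y = k * oinner x y.
Proof. by octvar x; octvar y; octring. Qed.

Lemma oinnerZr k x y : oinner x (k *: y) = k * oinner x y.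
Proof. by octvar x; octvar y; octring. Qed.

Lemma oinner_conj x y : oinner (oconj x) (oconj y) = oinner x y.
Proof. by octvar x; octvar y; octring. Qed.

Lemma oinnerMr x y z : oinner (omul x z) (omul y z) = onorm2 z * oinner x y.
Proof. by octvar x; octvar y; octvar z; octring. Qed.

Lemma oinnerMl x y z : oinner (omul z x) (omul z y) = onorm2 z * oinner x y.
Proof. by octvar x; octvar y; octvar z; octring. Qed.

Lemma onorm2D x y : onorm2 (x + y) = onorm2 x + 2 * oinner x y + onorm2 y.
Proof. by octvar x; octvar y; octring. Qed.

Lemma ore_mul_conj x y : ore (omul x (oconj y)) = oinner x y.
Proof. by []. Qed.

Lemma oreZ k x : ore (k *: x) = k * ore x.
Proof. by octvar x; octring. Qed.

(** Everything lies in the subalgebra generated by the two octonions [x] and [y], which is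
    associative by Artin's theorem. Rotations and boosts produce such [p] and [q] from a coordinate
    1 and one other coordinate. *)
Lemma span_assocl a b c d x y :
  let p := a *: oone R + b *: x in let q := c *: oone R + d *: x in
  omul (omul p (oconj q)) (omul q y) = onorm2 q *: omul p y.
Proof. by move=> p q; rewrite {}/p {}/q; octvar x; octvar y; octring. Qed.

Lemma span_assocr a b c d x y :
  let p := a *: oone R + b *: x in let q := c *: oone R + d *: x in
  omul (omul y (oconj q)) (omul q (oconj p)) = onorm2 q *: omul y (oconj p).
Proof.
move=> p q; have := span_assocl a b c d x (oconj y); rewrite -/p -/q => /(congr1 (@oconj R)).
by rewrite oconjZ !oconjM !oconjK.
Qed.

Lemma span_assocm a b c d x y :
  let p := a *: oone R + b *: x in let q := c *: oone R + d *: x in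
  omul (omul p (oconj y)) (omul y (oconj q)) = onorm2 y *: omul p (oconj q).
Proof. by move=> p q; rewrite {}/p {}/q; octvar x; octvar y; octring. Qed.

(** Flexibility (x y) x = x (y x) passes to the conjugate, which is a real multiple of 1 minus
    [x]. *)
Lemma omul_flex x y : omul (omul (oconj x) y) x = omul (oconj x) (omul y x).
Proof. by octvar x; octvar y; octring. Qed.

Lemma oinner_conjr x y : oinner x (oconj y) = 2 * ore x * ore y - oinner x y.
Proof. by octvar x; octvar y; octring. Qed.

Lemma oinner_conjl x y : oinner (oconj x) y = 2 * ore x * ore y - oinner x y.
Proof. by octvar x; octvar y; octring. Qed.

Lemma oinner1o x : oinner (oone R) x = ore x.
Proof. by octvar x; octring. Qed.

Lemma oinnero1 x : oinner x (oone R) = ore x.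
Proof. by octvar x; octring. Qed.

Lemma ore1 : ore (oone R) = 1.
Proof. by octring. Qed.

(** The right-hand side sees [x] and [y] only through entries of their projector, and linearly. This
    is what lets a rotation of coordinates act on matrices. *)
Lemma omul_rot c s k x y :
  k *: omul (c *: x + (- s) *: y) (oconj (s *: x + c *: y)) =
  (c * s * (k * onorm2 x + - (k * onorm2 y))) *: oone R
  + c ^+ 2 *: (k *: omul x (oconj y)) + (- s ^+ 2) *: oconj (k *: omul x (oconj y)).
Proof. by octvar x; octvar y; octring. Qed.

Lemma omul_boost c s k x y :
  k *: omul (c *: x + s *: y) (oconj (s *: x + c *: y)) =
  (c * s * (k * onorm2 x + k * onorm2 y)) *: oone R
  + c ^+ 2 *: (k *: omul x (oconj y)) + s ^+ 2 *: oconj (k *: omul x (oconj y)).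
Proof. by octvar x; octvar y; octring. Qed.

End Algebra.

(** * Projectors of points and the two charts *)

Record hermitian (R : realType) := Hermitian {
  h1 : R; h2 : R; h3 : R; h12 : oct R; h13 : oct R; h23 : oct R }.

Section Projectors.
Variable R : realType.
Implicit Types (c s k : R) (u v x y z : oct R) (t : triple R) (P Q : hermitian R).

Definition tnorm t := let: (x, y, z) := t in onorm2 x + onorm2 y - onorm2 z.

Definition proj t : hermitian R :=
  let: (x, y, z) := t in let k := (tnorm t)^-1 in
  Hermitian (k * onorm2 x) (k * onorm2 y) (k * onorm2 z)
    (k *: omul x (oconj y)) (k *: omul x (oconj z)) (k *: omul y (oconj z)).

Definition is_proj P := exists2 t, inU t & P = proj t.

(** Non-vanishing of this entry is membership in the chart [j], where [true] stands for [1, u, v]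
    and [false] for [u, 1, v]. *)
Definition hdiag (j : bool) P := if j then h1 P else h2 P.

(** The quotients y x^{-1}, z x^{-1} or x y^{-1}, z y^{-1}, read off the entries by x^{-1} = \bar x
    / |x|^2; the common factor 1 / [tnorm] cancels. *)
Definition hchart (j : bool) P : coord R :=
  if j then ((h1 P)^-1 *: oconj (h12 P), (h1 P)^-1 *: oconj (h13 P))
  else ((h2 P)^-1 *: h12 P, (h2 P)^-1 *: oconj (h23 P)).

(* The two instances of associativity that make [x, y, z] the homogeneous
   coordinates of a point. *)
Definition tassoc t := let: (x, y, z) := t in
  omul (omul y (oconj x)) (omul x (oconj z)) = onorm2 x *: omul y (oconj z) /\
  omul (omul x (oconj y)) (omul y (oconj z)) = onorm2 y *: omul x (oconj z).

Lemma inU_cemb t : inU t <-> exists i (x : coord R), cdom x /\ t = cemb i x.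
Proof.
case: t => -[x y] z; split.
  case=> -[-> lt0]; [exists true, (y, z) | exists false, (x, z)]; split=> //.
  by rewrite /cdom/= (addrC 1).
by move=> [[] [[u v] [/= d [-> -> ->]]]]; [left | right]; split=> //; move: d;
   rewrite /cdom /= (addrC (onorm2 u)).
Qed.

Lemma cemb_inU i (x : coord R) : cdom x -> inU (cemb i x).
Proof. by move=> dx; apply/inU_cemb; exists i, x. Qed.

Lemma tnorm_cemb i (x : coord R) : tnorm (cemb i x) = 1 + onorm2 x.1 - onorm2 x.2.
Proof. by case: i; rewrite /tnorm/= onorm2_1 // (addrC (onorm2 _)). Qed.

Lemma tnorm_gt0 t : inU t -> 0 < tnorm t.
Proof. by move=> /inU_cemb[i [x [dx ->]]]; rewrite tnorm_cemb. Qed.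

(** One coordinate is 1, so each product involves only two octonions and alternativity suffices. *)
Lemma tassoc_inU t : inU t -> tassoc t.
Proof.
move=> /inU_cemb[[] [[u v] [_ ->]]]; split;
by rewrite ?(onorm2_1, omul1o, oconj1, omulo1, scale1r) // omulVKl.
Qed.

Lemma hchart_proj t (j : bool) : let: (x, y, z) := t in tnorm t != 0 ->
  hchart j (proj t) =
  if j then ((onorm2 x)^-1 *: omul y (oconj x), (onorm2 x)^-1 *: omul z (oconj x))
  else ((onorm2 y)^-1 *: omul x (oconj y), (onorm2 y)^-1 *: omul z (oconj y)).
Proof.
case: t => -[x y] z; rewrite /hchart /proj /=; set k := _ - _ => k0.
by case: j; rewrite ?oconjZ !scalerA ?oconjM ?oconjK invfM invrK mulrAC divff // mul1r.
Qed.

Lemma hchartK j (x : coord R) : cdom x -> hchart j (proj (cemb j x)) = x.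
Proof.
move=> dx; have := tnorm_gt0 (cemb_inU j dx).
case: x dx => u v dx /lt0r_neq0; case: j => k0.
  have -> := @hchart_proj (oone R, u, v) true k0.
  by rewrite onorm2_1 invr1 !scale1r oconj1 !omulo1.
have -> := @hchart_proj (u, oone R, v) false k0.
by rewrite onorm2_1 invr1 !scale1r oconj1 !omulo1.
Qed.

(** Associativity enters only through the off-diagonal entry that avoids the coordinate [j]: after
    division by x it is (y \bar x)(x \bar z) / |x|^4, which [tassoc] reduces to y \bar z / |x|^2. *)
Lemma proj_cemb_hchart j t : 0 < tnorm t -> tassoc t -> hdiag j (proj t) != 0 ->
  cdom (hchart j (proj t)) /\ proj (cemb j (hchart j (proj t))) = proj t.
Proof.
case: t => -[x y] z k0 [A1 A2]; have kn0 := lt0r_neq0 k0.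
rewrite (@hchart_proj (x, y, z)) // /hdiag /proj; move: k0 kn0; rewrite /tnorm /cdom.
set k := onorm2 x + _ - _ => k0 kn0; case: j => /=; rewrite mulf_eq0 negb_or => /andP[_ n0].
- have n1 : 0 < onorm2 x by rewrite lt_def n0 onorm2_ge0.
  have E : 1 + (onorm2 x)^-1 ^+ 2 * (onorm2 y * onorm2 x)
     - (onorm2 x)^-1 ^+ 2 * (onorm2 z * onorm2 x) = k / onorm2 x by rewrite /k; field.
  rewrite !(onorm2Z, onorm2M, onorm2_conj, onorm2_1) !E; split; first exact: divr_gt0.
  rewrite !(oconjZ, omul1o, oconjM, oconjK, omulZl, omulZr) A1 !scalerA.
  by congr Hermitian; try lazymatch goal with |- _ *: _ = _ => congr (_ *: _) end; field; rewrite n0 kn0.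
- have n1 : 0 < onorm2 y by rewrite lt_def n0 onorm2_ge0.
  have E : (onorm2 y)^-1 ^+ 2 * (onorm2 x * onorm2 y) + 1
     - (onorm2 y)^-1 ^+ 2 * (onorm2 z * onorm2 y) = k / onorm2 y by rewrite /k; field.
  rewrite !(onorm2Z, onorm2M, onorm2_conj, onorm2_1) [1 + _]addrC !E.
  split; first exact: divr_gt0.
  rewrite !(oconjZ, omul1o, oconj1, omulo1, oconjM, oconjK, omulZl, omulZr) A2 !scalerA.
  by congr Hermitian; try lazymatch goal with |- _ *: _ = _ => congr (_ *: _) end; field; rewrite n0 kn0.
Qed.

(** With x = 0, positivity of [tnorm] leaves |y|^2 > |z|^2 >= 0. Hence two charts cover all
    points. *)
Lemma proj_hdiag t : 0 < tnorm t -> h1 (proj t) = 0 -> h2 (proj t) != 0.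
Proof.
case: t => -[x y] z k0 /eqP.
rewrite /= !mulf_eq0 invr_eq0 (negPf (lt0r_neq0 k0)) /= => /eqP x0.
apply: lt0r_neq0; move: k0; rewrite /tnorm x0 add0r subr_gt0.
by apply: le_lt_trans; exact: onorm2_ge0.
Qed.

(** Rotations and boosts destroy the coordinate 1 that [inU] demands; this recovers a representative
    in a chart. *)
Lemma proj_inU t : 0 < tnorm t -> tassoc t -> is_proj (proj t).
Proof.
move=> k0 At; have [j j0] : exists j, hdiag j (proj t) != 0.
  have [x0|x0] := eqVneq (h1 (proj t)) 0; last by exists true.
  by exists false; exact: proj_hdiag.
have [d e] := proj_cemb_hchart k0 At j0.
by exists (cemb j (hchart j (proj t))); [exact: cemb_inU | rewrite e].
Qed.

(** For general octonions (u x)(\bar x \bar v) may differ from |x|^2 u \bar v, so invariance under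
    right factors rests on [tassoc] for the multiplied triple. *)
Lemma proj_mulr1 u v x : onorm2 x != 0 -> 1 + onorm2 u - onorm2 v != 0 ->
  tassoc (x, omul u x, omul v x) ->
  proj (x, omul u x, omul v x) = proj (oone R, u, v).
Proof.
move=> l0 n0 [A1 _].
(* Here [tassoc] reads ((u x) \bar x)(x (\bar x \bar v)) = |x|^2 (u x)(\bar x \bar v), and its left
   side collapses to |x|^4 u \bar v. *)
have e : omul (omul u x) (oconj (omul v x)) = onorm2 x *: omul u (oconj v).
  by apply: (scalerI l0); rewrite -A1 omulKV oconjM omulKVl omulZl omulZr.
rewrite /proj /tnorm e !oconjM !omulKVl !onorm2M onorm2_1 !omul1o !scalerA.
have -> : onorm2 x + onorm2 u * onorm2 x - onorm2 v * onorm2 x =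
     onorm2 x * (1 + onorm2 u - onorm2 v) by ring.
by congr Hermitian; try lazymatch goal with |- _ *: _ = _ => congr (_ *: _) end;
  field; rewrite l0 n0.
Qed.

Lemma proj_mulr2 u v x : onorm2 x != 0 -> onorm2 u + 1 - onorm2 v != 0 ->
  tassoc (omul u x, x, omul v x) ->
  proj (omul u x, x, omul v x) = proj (u, oone R, v).
Proof.
move=> l0 n0 [_ A2].
have e : omul (omul u x) (oconj (omul v x)) = onorm2 x *: omul u (oconj v).
  by apply: (scalerI l0); rewrite -A2 omulKV oconjM omulKVl omulZl omulZr.
rewrite /proj /tnorm e !oconjM !omulKVl omulKV !onorm2M onorm2_1 !omul1o.
rewrite oconj1 omulo1 !scalerA.
have -> : onorm2 u * onorm2 x + onorm2 x - onorm2 v * onorm2 x =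
     onorm2 x * (onorm2 u + 1 - onorm2 v) by ring.
by congr Hermitian; try lazymatch goal with |- _ *: _ = _ => congr (_ *: _) end;
  field; rewrite l0 n0.
Qed.

Lemma osim_proj t t' : inU t -> inU t' -> osim t t' -> proj t = proj t'.
Proof.
move=> /tassoc_inU; case: t => -[x y] z At Ut'.
move: (Ut') => /inU_cemb[i [[u v] [_ t'E]]]; move: Ut'; rewrite {}t'E.
move=> /tnorm_gt0/lt0r_neq0; case: i => n0 [l [/onorm2_neq0 l0 [xE [yE zE]]]].
  move: n0 At; rewrite tnorm_cemb xE yE zE omul1o => n0 At; exact: proj_mulr1.
move: n0 At; rewrite tnorm_cemb xE yE zE omul1o => n0 At.
by apply: proj_mulr2 => //; rewrite (addrC (onorm2 u)).
Qed.

Lemma Msim_proj t t' : Msim t t' -> proj t = proj t'.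
Proof.
elim=> {t t'} [t t' [Ut [Ut' e]]||? ? _ ->|? ? ? _ -> _ ->] //; exact: osim_proj.
Qed.

Lemma proj_cemb_sim (x y : coord R) : cdom x -> cdom y ->
  proj (cemb true x) = proj (cemb false y) -> osim (cemb true x) (cemb false y).
Proof.
case: x y => [u v] [u' v'] dx dy /=.
have := tnorm_gt0 (cemb_inU true dx); have := tnorm_gt0 (cemb_inU false dy).
rewrite /proj /tnorm /=; set k' := _ - _; set k := _ - _ => k'0 k0.
rewrite onorm2_1 oconj1 omulo1 !omul1o mulr1 => e.
have e1 := congr1 (@h1 R) e; have e2 := congr1 (@h12 R) e.
have e3 := congr1 (@h13 R) e; rewrite {e} /= in e1 e2 e3.
have n0 := lt0r_neq0 k0; have n0' := lt0r_neq0 k'0.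
have uE : u = (k / k') *: oconj u'.
  apply: (can_inj (@oconjK R)); rewrite oconjZ oconjK -scalerA -e2.
  by rewrite scalerA divff // scale1r.
have vE : v = omul v' u.
  apply: (can_inj (@oconjK R)); rewrite uE omulZr oconjZ oconjM oconjK -scalerA -e3.
  by rewrite scalerA divff // scale1r.
have u'u : omul u' u = oone R.
  rewrite uE omulZr omul_conj scalerA -[RHS]scale1r; congr (_ *: _).
  by rewrite -mulrA -e1 divff.
(* The 1 in the second slot of [u', 1, v'] forces the factor to be [u]. *)
exists u; split; last by rewrite u'u omul1o -vE.
by move=> u0; move/(congr1 (@onorm2 R)): u'u; rewrite u0 omulo0 onorm2_0 onorm2_1 => /eqP; rewrite eq_sym oner_eq0.
Qed.

(** Within one chart [hchart] recovers the coordinates; across the charts the entries exhibit the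
    octonion factor, so one step of the relation is enough. *)
Lemma proj_Msim t t' : inU t -> inU t' -> proj t = proj t' -> Msim t t'.
Proof.
move=> Ut Ut'; move: (Ut) (Ut') => /inU_cemb[i [x [dx xE]]] /inU_cemb[j [y [dy yE]]].
case: (eqVneq i j) => [ij e|].
  have -> : t = t'; last exact: Relation_Operators.rst_refl.
  move: e; rewrite xE yE {}ij => /(congr1 (hchart j)).
  by rewrite (hchartK j dx) (hchartK j dy) => ->.
case: i j xE yE => -[] // xE yE _ e.
  apply: Relation_Operators.rst_step; split=> //; split=> //.
  by move: e; rewrite xE yE; exact: proj_cemb_sim.
apply: Relation_Operators.rst_sym; apply: Relation_Operators.rst_step; split=> //; split=> //.
by move: e; rewrite xE yE => e; apply: proj_cemb_sim.
Qed.

(** This is Re tr(P J Q J) with J = diag(1, 1, -1), the trace form twisted by the signature. It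
    equals 1 on a projector paired with itself. *)
Definition hform P Q := h1 P * h1 Q + h2 P * h2 Q + h3 P * h3 Q
  + 2 * oinner (h12 P) (h12 Q) - 2 * oinner (h13 P) (h13 Q) - 2 * oinner (h23 P) (h23 Q).

(* The numerator of the chordal distance of two points in a chart is exactly
   quadratic in the displacement, and it is the numerator of the metric. *)
Lemma hform_chord i (x w : coord R) : cdom x -> cdom (x + w) ->
  (1 + onorm2 (x + w).1 - onorm2 (x + w).2)
    * (1 - hform (proj (cemb i x)) (proj (cemb i (x + w))))
  = (1 + onorm2 x.1 - onorm2 x.2) * gmet x w.
Proof.
case: x w => [u v] [xi eta] dx dw.
have n0 := lt0r_neq0 dx; have n1 := lt0r_neq0 dw.
(* The only entry multiplying two chart coordinates is u \bar v. Its term <u \bar v, xi \bar eta>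
   supplies the real part in the numerator of the metric. *)
have key : oinner (omul u (oconj v)) (omul (u + xi) (oconj (v + eta))) =
   onorm2 u * onorm2 v + onorm2 u * oinner v eta + onorm2 v * oinner u xi
   + ore (omul (omul u (oconj v)) (omul eta (oconj xi))).
  have -> : ore (omul (omul u (oconj v)) (omul eta (oconj xi)))
      = oinner (omul u (oconj v)) (omul xi (oconj eta)).
    by rewrite -ore_mul_conj oconjM oconjK.
  rewrite oconjD omulDl !omulDr !oinnerDr (oinnerMl (oconj v) (oconj v)).
  rewrite (oinnerMl (oconj v) (oconj eta)) (oinnerMr u xi) !oinner_conj.
  by rewrite onorm2_conj oinnerxx; ring.
move: n0 n1 key; case: i; rewrite /proj /hform /gmet /tnorm /=.
  rewrite !(onorm2D, onorm2_1, omul1o, oinnerZl, oinnerZr, oinner_conj) => n0 n1 key.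
  rewrite key !oinnerDr !oinnerxx; field; by rewrite n0 n1.
rewrite !(onorm2D, onorm2_1, omul1o, oconj1, omulo1, oinnerZl, oinnerZr, oinner_conj) => n0 n1 key.
rewrite key !oinnerDr !oinnerxx [onorm2 u + 1]addrC [_ + onorm2 xi + 1]addrC.
by field; rewrite n0 n1.
Qed.

End Projectors.

(** * Rational maps and their smoothness *)

Section RationalMaps.
Variable R : realType.
Local Notation E := (coord R).
Implicit Types (D : set E) (f g : E -> R) (x w : E).

(** Denominators must be nonzero on [D] only. The class is closed under directional derivatives on
    [D], which gives all orders of differentiability by induction. *)
Inductive rational D : (E -> R) -> Prop :=
| rational_cst (k : R) : rational D (fun=> k)
| rational_lin (l : E -> R) : (forall k x y, l (k *: x + y) = k * l x + l y) ->
    continuous l -> rational D l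
| rational_add f g : rational D f -> rational D g -> rational D (fun x => f x + g x)
| rational_mul f g : rational D f -> rational D g -> rational D (fun x => f x * g x)
| rational_inv f : (forall x, D x -> f x != 0) -> rational D f ->
    rational D (fun x => (f x)^-1).

Lemma rational_opp D f : rational D f -> rational D (fun x => - f x).
Proof.
move=> rf; have -> : (fun x => - f x) = (fun x => -1 * f x).
  by apply/funext => x; rewrite mulN1r.
by apply: rational_mul => //; exact: rational_cst.
Qed.

Lemma rational_continuous D f x : rational D f -> D x -> {for x, continuous f}.
Proof.
move=> rf Dx; elim: rf => {f} [k|l _ cl|f g _ cf _ cg|f g _ cf _ cg|f f0 _ cf].
- exact: cvg_cst.
- exact: cl.
- exact: cvgD.
- exact: cvgM.
- by apply: cvgV => //; exact: f0.
Qed.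

Lemma rational_derive D f w : rational D f ->
  exists2 f', rational D f' & forall x, D x -> is_derive x w f (f' x).
Proof.
elim=> {f} [k|l linl cl|f g rf [f' rf' df] rg [g' rg' dg]|
  f g rf [f' rf' df] rg [g' rg' dg]|f f0 rf [f' rf' df]].
- by exists (fun=> 0); [exact: rational_cst | move=> x _; exact: is_derive_cst].
- exists (fun=> l w); first exact: rational_cst.
  move=> x _.
  (* The difference quotient of a linear function equals [l w] at every nonzero [h]. *)
  have cv : h^-1 *: (l (h *: w + x) - l x) @[h --> 0^'] --> l w.
    apply: cvg_near_cst; near=> h.
    rewrite linl addrK [_ *: _]mulKf //; near: h; exact: nbhs_dnbhs_neq.
  by apply: DeriveDef; [apply/cvg_ex; exists (l w) | exact: cvg_lim].
- exists (fun x => f' x + g' x); first exact: rational_add.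
  by move=> x Dx; apply: is_deriveD; [exact: df | exact: dg].
- exists (fun x => f x * g' x + g x * f' x).
    by apply: rational_add; apply: rational_mul.
  by move=> x Dx; apply: is_deriveM; [exact: df | exact: dg].
- exists (fun x => - ((f x)^-1 * (f x)^-1) * f' x).
    apply: rational_mul => //; apply: rational_opp.
    by apply: rational_mul; exact: rational_inv.
  move=> x Dx; have [? dfx] := df x Dx; apply: DeriveDef.
    by apply: derivableV => //; exact: f0.
  by rewrite deriveV ?f0 // dfx expr2 invfM.
Unshelve. all: by end_near. Qed.

Inductive rational_vec D : (E -> E) -> Prop :=
| rational_vec_scale f (e : E) : rational D f -> rational_vec D (fun x => f x *: e)
| rational_vec_add (F G : E -> E) : rational_vec D F -> rational_vec D G ->
    rational_vec D (fun x => F x + G x).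

Lemma rational_vec_continuous D (F : E -> E) x :
  rational_vec D F -> D x -> {for x, continuous F}.
Proof.
move=> rF Dx; elim: rF => {F} [f e rf|F G _ cF _ cG]; last exact: cvgD.
by apply: cvgZr_tmp; exact: rational_continuous rf Dx.
Qed.

Lemma rational_vec_derive D (F : E -> E) w : rational_vec D F ->
  exists2 F', rational_vec D F' & forall x, D x -> is_derive x w F (F' x).
Proof.
elim=> {F} [f e rf|F G _ [F' rF' dF] _ [G' rG' dG]].
  have [f' rf' df] := rational_derive w rf.
  exists (fun x => f' x *: e); first exact: rational_vec_scale.
  move=> x Dx; have [dfx fxE] := df x Dx.
  have cv : h^-1 *: (f (h *: w + x) *: e - f x *: e) @[h --> 0^'] --> f' x *: e.
    have -> : (fun h => h^-1 *: (f (h *: w + x) *: e - f x *: e)) =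
        (fun h => (h^-1 *: (f (h *: w + x) - f x)) *: e).
      by apply/funext => h; rewrite -scalerBl scalerA.
    by apply: cvgZr_tmp; rewrite -fxE; exact: dfx.
  by apply: DeriveDef; [apply/cvg_ex; exists (f' x *: e) | exact: cvg_lim].
exists (fun x => F' x + G' x); first exact: rational_vec_add.
by move=> x Dx; apply: is_deriveD; [exact: dF | exact: dG].
Qed.

(** An iterated derivative is known to agree with a rational map only on [D]. Openness turns this
    into agreement near each point, which survives the next derivative. *)
Lemma rational_vec_smooth D (F : E -> E) : open D -> rational_vec D F -> smooth_on D F.
Proof.
move=> oD rF vs.
have [G rG FG] : exists2 G, rational_vec D G & forall x, D x -> iterD vs F x = G x.
  elim: vs => [|w vs [G rG FG]]; first by exists F.
  have [G' rG' dG] := rational_vec_derive w rG.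
  exists G' => // x Dx /=; have [_ <-] := dG x Dx.
  apply: near_eq_derive; near=> y; apply: FG; near: y.
  exact: open_nbhs_nbhs.
move=> x Dx; have nE : {near x, G =1 iterD vs F}.
  by near=> y; apply/esym/FG; near: y; exact: open_nbhs_nbhs.
split=> [|w].
  change (iterD vs F y @[y --> x] --> iterD vs F x); rewrite (FG x Dx).
  by apply: cvg_trans (rational_vec_continuous rG Dx); exact: near_eq_cvg.
have [G' _ dG] := rational_vec_derive w rG; have [dGx _] := dG x Dx.
exact: near_eq_derivable nE dGx.
Unshelve. all: by end_near. Qed.

Definition rational_quat D (q : E -> quat R) :=
  forall n, rational D (fun x => qc (q x) n).
Definition rational_oct D (a : E -> oct R) :=
  rational_quat D (fun x => (a x).1) /\ rational_quat D (fun x => (a x).2).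

Ltac rat := repeat first
  [ done | assumption | apply: rational_cst | apply: rational_add
  | apply: rational_opp | apply: rational_mul ].

Lemma rational_mkq D f1 f2 f3 f4 : rational D f1 -> rational D f2 ->
  rational D f3 -> rational D f4 ->
  rational_quat D (fun x => mkq (f1 x) (f2 x) (f3 x) (f4 x)).
Proof.
move=> r1 r2 r3 r4 n; rewrite /qc.
have -> : (fun x => mkq (f1 x) (f2 x) (f3 x) (f4 x) ord0 (inord n)) =
  (fun x => nth 0 [:: f1 x; f2 x; f3 x; f4 x] (inord n : 'I_4)).
  by apply/funext => x; rewrite mxE.
by case: (inord n : 'I_4) => -[|[|[|[|m]]]] //= ?; apply: rational_cst.
Qed.

Lemma rational_qmul D q r : rational_quat D q -> rational_quat D r ->
  rational_quat D (fun x => qmul (q x) (r x)).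
Proof. by move=> rq rr; apply: rational_mkq; rat. Qed.

Lemma rational_qconj D q : rational_quat D q -> rational_quat D (fun x => qconj (q x)).
Proof. by move=> rq; apply: rational_mkq; rat. Qed.

Lemma rational_qadd D q r : rational_quat D q -> rational_quat D r ->
  rational_quat D (fun x => q x + r x).
Proof.
move=> rq rr n; have -> : (fun x => qc (q x + r x) n) = (fun x => qc (q x) n + qc (r x) n).
  by apply/funext => x; rewrite /qc mxE.
by rat.
Qed.

Lemma rational_qopp D q : rational_quat D q -> rational_quat D (fun x => - q x).
Proof.
move=> rq n; have -> : (fun x => qc (- q x) n) = (fun x => - qc (q x) n).
  by apply/funext => x; rewrite /qc mxE.
by rat.
Qed.

Lemma rational_qscale D f q : rational D f -> rational_quat D q ->
  rational_quat D (fun x => f x *: q x).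
Proof.
move=> rf rq n; have -> : (fun x => qc (f x *: q x) n) = (fun x => f x * qc (q x) n).
  by apply/funext => x; rewrite /qc mxE.
by rat.
Qed.

Lemma rational_ocst D (a : oct R) : rational_oct D (fun=> a).
Proof. by split=> n; exact: rational_cst. Qed.

Lemma rational_omul D a b : rational_oct D a -> rational_oct D b ->
  rational_oct D (fun x => omul (a x) (b x)).
Proof.
move=> [ra1 ra2] [rb1 rb2]; split; apply: rational_qadd; try apply: rational_qopp;
by apply: rational_qmul => //; exact: rational_qconj.
Qed.

Lemma rational_oconj D a : rational_oct D a -> rational_oct D (fun x => oconj (a x)).
Proof. by move=> [? ?]; split; [apply: rational_qconj | apply: rational_qopp]. Qed.

Lemma rational_oadd D a b : rational_oct D a -> rational_oct D b ->
  rational_oct D (fun x => a x + b x).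
Proof. by move=> [? ?] [? ?]; split; apply: rational_qadd. Qed.

Lemma rational_oscale D f a : rational D f -> rational_oct D a ->
  rational_oct D (fun x => f x *: a x).
Proof. by move=> ? [? ?]; split; apply: rational_qscale. Qed.

Lemma rational_ore D a : rational_oct D a -> rational D (fun x => ore (a x)).
Proof. by case=> + _; apply. Qed.

Lemma rational_oinner D a b : rational_oct D a -> rational_oct D b ->
  rational D (fun x => oinner (a x) (b x)).
Proof. by move=> ra rb; apply/rational_ore/rational_omul => //; exact: rational_oconj. Qed.

Lemma rational_onorm2 D a : rational_oct D a -> rational D (fun x => onorm2 (a x)).
Proof. by move=> ra; exact: rational_oinner. Qed.

Lemma rational_lin_oct D (l : E -> oct R) : (forall k x y, l (k *: x + y) = k *: l x + l y) ->
  continuous l -> rational_oct D l.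
Proof.
move=> ll cl; split=> n; apply: rational_lin => [k x y|x]; rewrite ?ll /qc ?mxE //.
- apply: (@continuous_comp _ _ _ (fun x => (l x).1) (fun q : quat R => q ord0 (inord n))).
    by apply: (@continuous_comp _ _ _ l fst); [exact: cl | exact: cvg_fst].
  exact: coord_continuous.
- apply: (@continuous_comp _ _ _ (fun x => (l x).2) (fun q : quat R => q ord0 (inord n))).
    by apply: (@continuous_comp _ _ _ l snd); [exact: cl | exact: cvg_snd].
  exact: coord_continuous.
Qed.

Lemma rational_fst D : rational_oct D fst.
Proof. by apply: rational_lin_oct => // x; exact: cvg_fst. Qed.

Lemma rational_snd D : rational_oct D snd.
Proof. by apply: rational_lin_oct => // x; exact: cvg_snd. Qed.

Lemma rational_vec_linear D (l : quat R -> E) (q : E -> quat R) : linear l ->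
  rational_quat D q -> rational_vec D (fun x => l (q x)).
Proof.
move=> ll rq; have -> : (fun x => l (q x)) = (fun x =>
   qc (q x) 0 *: l (mkq 1 0 0 0) + qc (q x) 1 *: l (mkq 0 1 0 0)
   + qc (q x) 2 *: l (mkq 0 0 1 0) + qc (q x) 3 *: l (mkq 0 0 0 1)).
  apply/funext => x; rewrite -!addrA.
  have l0 : l 0 = 0 by have := ll (-1) 0 0; rewrite scaler0 addr0 scaleN1r addNr.
  rewrite -[X in _ + (_ + (_ + X))]addr0 -l0 -!ll !mkqZ mkq0 !mkqD.
  rewrite {1}(mkq_eta (q x)); congr (l (mkq _ _ _ _)); ring.
by do !apply: rational_vec_add; apply: rational_vec_scale.
Qed.

Lemma rational_vec_pair D (a b : E -> oct R) : rational_oct D a -> rational_oct D b ->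
  rational_vec D (fun x => (a x, b x)).
Proof.
move=> [ra1 ra2] [rb1 rb2].
(* The pair is split into its four quaternionic slots, each a linear injection. *)
have -> : (fun x => (a x, b x)) = (fun x =>
    ((((a x).1, 0), 0) : E) + ((0, (a x).2), 0) + (0, ((b x).1, 0)) + (0, (0, (b x).2))).
  apply/funext => x; case: (a x) (b x) => [a1 a2] [b1 b2] /=.
  by congr pair; congr pair; rewrite /= ?(add0r, addr0).
do !apply: rational_vec_add.
- apply: (@rational_vec_linear _ (fun q => ((q, 0), 0))) => // k q r.
  by congr pair; [congr pair|]; rewrite /= ?scaler0 ?addr0.
- apply: (@rational_vec_linear _ (fun q => ((0, q), 0))) => // k q r.
  by congr pair; [congr pair|]; rewrite /= ?scaler0 ?addr0.
- apply: (@rational_vec_linear _ (fun q => (0, (q, 0)))) => // k q r.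
  by congr pair; [|congr pair]; rewrite /= ?scaler0 ?addr0.
- apply: (@rational_vec_linear _ (fun q => (0, (0, q)))) => // k q r.
  by congr pair; [|congr pair]; rewrite /= ?scaler0 ?addr0.
Qed.

End RationalMaps.

(** * Symmetries of the set of projectors *)

Section Symmetries.
Variable R : realType.
Local Notation E := (coord R).
Implicit Types (c s k : R) (u v x y z : oct R) (t : triple R) (P Q : hermitian R).
Implicit Types (L : hermitian R -> hermitian R).

Definition rational_herm (D : set E) (Psi : E -> hermitian R) :=
  [/\ rational D (fun p : E => h1 (Psi p)), rational D (fun p : E => h2 (Psi p))
    & rational D (fun p : E => h3 (Psi p))] /\
  [/\ rational_oct D (fun p : E => h12 (Psi p)), rational_oct D (fun p : E => h13 (Psi p))
    & rational_oct D (fun p : E => h23 (Psi p))].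

(** Rationality is stated for composites with a rational family, so that symmetries compose at once
    and [hermitian] needs no topology. *)
Record hsymmetry L : Prop := HSymmetry {
  hsymmetry_proj : forall P, is_proj P -> is_proj (L P);
  hsymmetry_form : forall P Q, hform (L P) (L Q) = hform P Q;
  hsymmetry_rational : forall D Psi, rational_herm D Psi ->
    rational_herm D (fun p : E => L (Psi p)) }.

(** The inverse is carried along because an isometry must come with one. It is demanded on
    projectors only, where cancellation can be checked on triples. *)
Definition moves P Q := exists L L', [/\ hsymmetry L, hsymmetry L',
  forall P', is_proj P' -> L' (L P') = P', forall P', is_proj P' -> L (L' P') = P' & L P = Q].

Lemma moves_trans P Q T : moves P Q -> moves Q T -> moves P T.
Proof.
move=> [L [L' [sL sL' K K' <-]]] [M [M' [sM sM' KM KM' <-]]].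
have comp A B : hsymmetry A -> hsymmetry B -> hsymmetry (A \o B).
  move=> [pA fA rA] [pB fB rB]; split=> [T' /pB/pA //|T' Q'|D Psi /rB/rA //].
  by rewrite /= fA fB.
exists (M \o L), (L' \o M'); split; [exact: comp|exact: comp| | |by []].
- by move=> T' pT' /=; rewrite KM ?K //; exact: hsymmetry_proj.
- by move=> T' pT' /=; rewrite K' ?KM' //; exact: hsymmetry_proj.
Qed.

Lemma moves_sym P Q : is_proj P -> moves P Q -> moves Q P.
Proof. by move=> pP [L [L' [sL sL' K K' <-]]]; exists L', L; split=> //; exact: K. Qed.

Ltac rat := repeat first
  [ done | assumption | apply: rational_cst | apply: rational_add
  | apply: rational_opp | apply: rational_mul | apply: rational_ore
  | apply: rational_oadd | apply: rational_oscale | apply: rational_omul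
  | apply: rational_oconj | apply: rational_ocst].

(** * Unit octonions acting by (u, v) |-> (\bar x u, x v) *)

Definition htri x P := Hermitian (h1 P) (h2 P) (h3 P) (omul (h12 P) x)
  (omul (h13 P) (oconj x)) (omul (oconj x) (omul (h23 P) (oconj x))).

(** The middle Moufang identity gives (\bar x u)(\bar v \bar x) = \bar x (u \bar v) \bar x for the
    entry 23. *)
Lemma htri_proj1 x u v : onorm2 x = 1 ->
  htri x (proj (oone R, u, v)) = proj (oone R, omul (oconj x) u, omul x v).
Proof.
move=> x1; rewrite /htri /proj /tnorm /= !omul1o !onorm2M onorm2_conj x1 !mul1r.
by rewrite !oconjM oconjK moufang_mid !omulZl omulZr.
Qed.

(** In this chart the entry 13 is u \bar v, and the right Moufang identity gives (u x)(\bar x (\bar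
    v \bar x)) = (u \bar v) \bar x for a unit [x]. *)
Lemma htri_proj2 x u v : onorm2 x = 1 ->
  htri x (proj (u, oone R, v)) = proj (omul u x, oone R, omul (omul x v) x).
Proof.
move=> x1; rewrite /htri /proj /tnorm /= !omul1o !onorm2M x1 !(mul1r, mulr1).
by rewrite oconj1 !omulo1 !oconjM moufang_right x1 scale1r !omulZl omulZr.
Qed.

Lemma htriK x P : onorm2 x = 1 -> htri (oconj x) (htri x P) = P.
Proof.
move=> x1; case: P => p1 p2 p3 x12 x13 x23; rewrite /htri /= oconjK.
by rewrite omulKV omulVK omul_flex omulVK !omulZr omulKVl x1 !scale1r.
Qed.

Lemma hsymmetry_htri x : onorm2 x = 1 -> hsymmetry (htri x).
Proof.
move=> x1; split=> [_ [t Ut ->]|P Q|D Psi [[? ? ?] [? ? ?]]].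
- move: Ut => /inU_cemb[i [[u v] [d ->]]]; case: i.
    exists (cemb true (omul (oconj x) u, omul x v)); last exact: htri_proj1.
    by apply: cemb_inU; move: d; rewrite /cdom /= !onorm2M onorm2_conj x1 !mul1r.
  exists (cemb false (omul u x, omul (omul x v) x)); last exact: htri_proj2.
  by apply: cemb_inU; move: d; rewrite /cdom /= !onorm2M x1 !(mul1r, mulr1).
- by rewrite /hform /= oinnerMl !oinnerMr onorm2_conj x1 !mul1r.
- by split; split; rat.
Qed.

Lemma moves_htri x P : onorm2 x = 1 -> moves P (htri x P).
Proof.
move=> x1; have x1' : onorm2 (oconj x) = 1 by rewrite onorm2_conj.
exists (htri x), (htri (oconj x)); split=> // [||P' _|P' _].
- exact: hsymmetry_htri.
- exact: hsymmetry_htri.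
- exact: htriK.
- by rewrite -{1}(oconjK x); exact: htriK.
Qed.

(** * Real rotations of the first two coordinates *)

Definition trot c s t : triple R := let: (x, y, z) := t in
  (c *: x + (- s) *: y, s *: x + c *: y, z).

(** Conjugation of the Hermitian matrix by the rotation. The rotation is real, so the result is
    linear in the entries and bracketing is immaterial. *)
Definition hrot c s P := Hermitian
  (c ^+ 2 * h1 P + s ^+ 2 * h2 P + - (2 * c * s * ore (h12 P)))
  (s ^+ 2 * h1 P + c ^+ 2 * h2 P + 2 * c * s * ore (h12 P))
  (h3 P)
  ((c * s * (h1 P + - h2 P)) *: oone R + c ^+ 2 *: h12 P + (- s ^+ 2) *: oconj (h12 P))
  (c *: h13 P + (- s) *: h23 P) (s *: h13 P + c *: h23 P).

Lemma tnorm_trot c s t : c ^+ 2 + s ^+ 2 = 1 -> tnorm (trot c s t) = tnorm t.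
Proof.
case: t => -[x y] z cs; rewrite /tnorm /=; congr (_ - _).
rewrite -[RHS]mul1r -cs !onorm2D !onorm2Z !oinnerZl !oinnerZr; ring.
Qed.

Lemma hrot_proj c s t : c ^+ 2 + s ^+ 2 = 1 -> hrot c s (proj t) = proj (trot c s t).
Proof.
move=> cs; have := tnorm_trot t cs; case: t => -[x y] z e.
rewrite /hrot /proj [trot _ _ _]/= in e *; rewrite {}e /=; set k := _^-1.
congr Hermitian.
- by rewrite onorm2D !onorm2Z oreZ ore_mul_conj oinnerZl oinnerZr; ring.
- by rewrite onorm2D !onorm2Z oreZ ore_mul_conj oinnerZl oinnerZr; ring.
- exact: esym (omul_rot c s k x y).
- by rewrite omulDl !omulZl scalerDr !scalerA !(mulrC k).
- by rewrite omulDl !omulZl scalerDr !scalerA !(mulrC k).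
Qed.

Lemma trotK c s t : c ^+ 2 + s ^+ 2 = 1 -> trot c (- s) (trot c s t) = t.
Proof.
case: t => -[x y] z cs; rewrite /trot; congr (_, _, _).
- rewrite !scalerDr !scalerA opprK addrACA -!scalerDl.
  have -> : c * c + s * s = 1 by rewrite -cs; ring.
  have -> : c * - s + s * c = 0 by ring.
  by rewrite scale1r scale0r addr0.
- rewrite !scalerDr !scalerA addrACA -!scalerDl.
  have -> : - s * c + c * s = 0 by ring.
  have -> : - s * - s + c * c = 1 by rewrite -cs; ring.
  by rewrite scale1r scale0r add0r.
Qed.

Lemma hsymmetry_hrot c s : c ^+ 2 + s ^+ 2 = 1 -> hsymmetry (hrot c s).
Proof.
move=> cs; split=> [_ [t Ut ->]|P Q|D Psi [[? ? ?] [? ? ?]]].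
- rewrite hrot_proj //; apply: proj_inU; first by rewrite tnorm_trot // tnorm_gt0.
  (* In both charts the first two rotated coordinates are real combinations of 1 and [u], so with
     [v] they generate an associative algebra. *)
  move: Ut => /inU_cemb[[] [[u v] [d ->]]]; rewrite /=.
    by split; exact: span_assocl.
  by rewrite ![_ + _ *: oone R]addrC; split; exact: span_assocl.
(* Before normalisation, the block of the first two coordinates scales by (c^2 + s^2)^2 and the
   entries 13, 23 by c^2 + s^2. *)
- have -> : hform (hrot c s P) (hrot c s Q) =
    (c ^+ 2 + s ^+ 2) ^+ 2 * (h1 P * h1 Q + h2 P * h2 Q + 2 * oinner (h12 P) (h12 Q))
    + h3 P * h3 Q - 2 * (c ^+ 2 + s ^+ 2) *
      (oinner (h13 P) (h13 Q) + oinner (h23 P) (h23 Q)).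
    rewrite /hform /= !(oinnerDl, oinnerDr, oinnerZl, oinnerZr) oinner_conj.
    by rewrite !oinner_conjr !oinner_conjl !oinner1o !oinnero1 ore1; ring.
  by rewrite cs /hform; ring.
- by split; split; rat.
Qed.

Lemma moves_trot c s t : inU t -> c ^+ 2 + s ^+ 2 = 1 ->
  moves (proj t) (proj (trot c s t)).
Proof.
move=> Ut cs; have cs' : c ^+ 2 + (- s) ^+ 2 = 1 by rewrite sqrrN.
exists (hrot c s), (hrot c (- s)); split=> [||_ [t' _ ->]|_ [t' _ ->]|].
- exact: hsymmetry_hrot.
- exact: hsymmetry_hrot.
- by rewrite !hrot_proj // trotK.
- by rewrite !hrot_proj //; rewrite -{1}(opprK s) trotK.
- exact: hrot_proj.
Qed.

(** * Real boosts of the first and third coordinates *)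

Definition tboost c s t : triple R := let: (x, y, z) := t in
  (c *: x + s *: z, y, s *: x + c *: z).

Definition hboost c s P := Hermitian
  (c ^+ 2 * h1 P + s ^+ 2 * h3 P + 2 * c * s * ore (h13 P)) (h2 P)
  (s ^+ 2 * h1 P + c ^+ 2 * h3 P + 2 * c * s * ore (h13 P))
  (c *: h12 P + s *: oconj (h23 P))
  ((c * s * (h1 P + h3 P)) *: oone R + c ^+ 2 *: h13 P + s ^+ 2 *: oconj (h13 P))
  (s *: oconj (h12 P) + c *: h23 P).

Lemma tnorm_tboost c s t : c ^+ 2 - s ^+ 2 = 1 -> tnorm (tboost c s t) = tnorm t.
Proof.
case: t => -[x y] z cs; rewrite /tnorm /= addrAC [RHS]addrAC; congr (_ + _).
rewrite -[RHS]mul1r -cs !onorm2D !onorm2Z !oinnerZl !oinnerZr; ring.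
Qed.

Lemma hboost_proj c s t : c ^+ 2 - s ^+ 2 = 1 ->
  hboost c s (proj t) = proj (tboost c s t).
Proof.
move=> cs; have := tnorm_tboost t cs; case: t => -[x y] z e.
rewrite /hboost /proj [tboost _ _ _]/= in e *; rewrite {}e /=; set k := _^-1.
congr Hermitian.
- by rewrite onorm2D !onorm2Z oreZ ore_mul_conj oinnerZl oinnerZr; ring.
- by rewrite onorm2D !onorm2Z oreZ ore_mul_conj oinnerZl oinnerZr; ring.
- by rewrite omulDl !omulZl oconjZ oconjM oconjK scalerDr !scalerA !(mulrC k).
- exact: esym (omul_boost c s k x z).
- by rewrite oconjD !oconjZ omulDr !omulZr oconjM oconjK scalerDr !scalerA !(mulrC k).
Qed.

Lemma tboostK c s t : c ^+ 2 - s ^+ 2 = 1 -> tboost c (- s) (tboost c s t) = t.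
Proof.
case: t => -[x y] z cs; rewrite /tboost; congr (_, _, _).
- rewrite !scalerDr !scalerA addrACA -!scalerDl.
  have -> : c * c + - s * s = 1 by rewrite -cs; ring.
  have -> : c * s + - s * c = 0 by ring.
  by rewrite scale1r scale0r addr0.
- rewrite !scalerDr !scalerA addrACA -!scalerDl.
  have -> : - s * c + c * s = 0 by ring.
  have -> : - s * s + c * c = 1 by rewrite -cs; ring.
  by rewrite scale1r scale0r add0r.
Qed.

Lemma hsymmetry_hboost c s : c ^+ 2 - s ^+ 2 = 1 -> hsymmetry (hboost c s).
Proof.
move=> cs; split=> [_ [t Ut ->]|P Q|D Psi [[? ? ?] [? ? ?]]].
- rewrite hboost_proj //; apply: proj_inU; first by rewrite tnorm_tboost // tnorm_gt0.
  move: Ut => /inU_cemb[[] [[u v] [d ->]]]; rewrite /=.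
    by split; [exact: span_assocr | exact: span_assocm].
  (* The boost leaves the middle coordinate 1 in place, so alternativity is enough in this chart. *)
  by split; rewrite !omul1o ?omulVKl // oconj1 omulo1 onorm2_1 scale1r.
- have -> : hform (hboost c s P) (hboost c s Q) =
    (c ^+ 2 - s ^+ 2) ^+ 2 * (h1 P * h1 Q + h3 P * h3 Q - 2 * oinner (h13 P) (h13 Q))
    + h2 P * h2 Q + 2 * (c ^+ 2 - s ^+ 2) *
      (oinner (h12 P) (h12 Q) - oinner (h23 P) (h23 Q)).
    rewrite /hform /= !(oinnerDl, oinnerDr, oinnerZl, oinnerZr) !oinner_conj.
    by rewrite !oinner_conjr !oinner_conjl !oinner1o !oinnero1 ore1; ring.
  by rewrite cs /hform; ring.
- by split; split; rat.
Qed.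

Lemma moves_tboost c s t : inU t -> c ^+ 2 - s ^+ 2 = 1 ->
  moves (proj t) (proj (tboost c s t)).
Proof.
move=> Ut cs; have cs' : c ^+ 2 - (- s) ^+ 2 = 1 by rewrite sqrrN.
exists (hboost c s), (hboost c (- s)); split=> [||_ [t' _ ->]|_ [t' _ ->]|].
- exact: hsymmetry_hboost.
- exact: hsymmetry_hboost.
- by rewrite !hboost_proj // tboostK.
- by rewrite !hboost_proj //; rewrite -{1}(opprK s) tboostK.
- exact: hboost_proj.
Qed.

(** * Moving every point to [1, 0, 0] *)

Lemma projZ k x y z : k != 0 -> proj (k *: x, k *: y, k *: z) = proj (x, y, z).
Proof.
move=> k0; rewrite /proj /tnorm !onorm2Z !oconjZ !(omulZl, omulZr) !scalerA.
rewrite -mulrDr -mulrBr invfM; move: (onorm2 x + _ - _)^-1 => T.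
by congr Hermitian; try lazymatch goal with |- _ *: _ = _ => congr (_ *: _) end;
  field.
Qed.

Lemma unit_part x : exists2 y, onorm2 y = 1 &
  omul (oconj y) x = Num.sqrt (onorm2 x) *: oone R.
Proof.
have [x0|x0] := eqVneq (onorm2 x) 0.
  exists (oone R); first exact: onorm2_1.
  by rewrite x0 sqrtr0 scale0r (onorm2_eq0 x0) omulo0.
have s0 : Num.sqrt (onorm2 x) != 0 by rewrite sqrtr_eq0 -ltNge lt_def x0 onorm2_ge0.
have e : Num.sqrt (onorm2 x) ^+ 2 = onorm2 x by rewrite sqr_sqrtr ?onorm2_ge0.
exists ((Num.sqrt (onorm2 x))^-1 *: x).
  by rewrite onorm2Z exprVn e mulVf.
by rewrite oconjZ omulZl omul_conjl scalerA -[X in _ * X]e expr2 mulKf.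
Qed.

Lemma moves_base1 u v : cdom (u, v) -> moves (proj (oone R, u, v)) (proj (oone R, 0, 0)).
Proof.
rewrite /cdom /= => d.
have [x x1 xu] := unit_part u; set r := Num.sqrt _ in xu.
have r2 : r ^+ 2 = onorm2 u by rewrite sqr_sqrtr ?onorm2_ge0.
apply: (moves_trans (moves_htri _ x1)); rewrite htri_proj1 // xu.
have v'E : onorm2 (omul x v) = onorm2 v by rewrite onorm2M x1 mul1r.
move: (omul x v) v'E => v' v'E.
(* The rotation with c = 1 / rho and s = -r / rho sends (1, r) to (rho, 0); dividing by the real
   number rho restores the coordinate 1. *)
pose rho := Num.sqrt (1 + r ^+ 2).
have rho2 : rho ^+ 2 = 1 + r ^+ 2 by rewrite sqr_sqrtr // addr_ge0 ?sqr_ge0.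
have rho0 : rho != 0.
  by rewrite sqrtr_eq0 -ltNge ltr_wpDr ?sqr_ge0.
have Ur : inU (oone R, r *: oone R, v').
  by left; split=> //; rewrite onorm2Z onorm2_1 mulr1 r2 v'E.
have cs : (rho^-1) ^+ 2 + (- r / rho) ^+ 2 = 1.
  have -> : (rho^-1) ^+ 2 + (- r / rho) ^+ 2 = (1 + r ^+ 2) / rho ^+ 2 by field.
  by rewrite -rho2 divff // expf_neq0.
apply: (moves_trans (moves_trot Ur cs)).
have -> : proj (trot rho^-1 (- r / rho) (oone R, r *: oone R, v')) =
    proj (oone R, 0, rho^-1 *: v').
  rewrite -(projZ (oone R) 0 (rho^-1 *: v') rho0) scaler0 scalerA divff // scale1r; congr proj.
  rewrite /trot !scalerA -!scalerDl; congr (_, _, _).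
    congr (_ *: _); have -> : rho^-1 + - (- r / rho) * r = (1 + r ^+ 2) / rho by field.
    by rewrite -rho2 expr2 mulfK.
  by have -> : - r / rho + rho^-1 * r = 0 :> R; [field | rewrite scale0r].
(* This is the chart condition |v|^2 < 1 + |u|^2 = rho^2; it makes the boost below possible. *)
have lt1 : onorm2 (rho^-1 *: v') < 1.
  rewrite onorm2Z v'E exprVn mulrC ltr_pdivrMr ?mul1r ?exprn_gt0 //.
    by rewrite rho2 r2 -subr_gt0.
  by rewrite lt_def rho0 sqrtr_ge0.
move: (rho^-1 *: v') lt1 => w lt1.
have [y y1 yw] := unit_part w; set q := Num.sqrt _ in yw.
have q2 : q ^+ 2 = onorm2 w by rewrite sqr_sqrtr ?onorm2_ge0.
(* The conjugate is used since [htri] multiplies the last coordinate by its parameter itself. *)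
have y1' : onorm2 (oconj y) = 1 by rewrite onorm2_conj.
apply: (moves_trans (moves_htri _ y1')); rewrite htri_proj1 // yw omulo0.
(* The boost with c = 1 / tau and s = -q / tau sends (1, q) to (tau, 0). *)
pose tau := Num.sqrt (1 - q ^+ 2).
have tau2 : tau ^+ 2 = 1 - q ^+ 2 by rewrite sqr_sqrtr // subr_ge0 q2 ltW.
have tau0 : tau != 0 by rewrite sqrtr_eq0 -ltNge subr_gt0 q2.
have Uq : inU (oone R, 0, q *: oone R).
  by left; split=> //; rewrite onorm2Z onorm2_1 onorm2_0 mulr1 addr0 q2 subr_gt0.
have cs' : (tau^-1) ^+ 2 - (- q / tau) ^+ 2 = 1.
  have -> : (tau^-1) ^+ 2 - (- q / tau) ^+ 2 = (1 - q ^+ 2) / tau ^+ 2 by field.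
  by rewrite -tau2 divff // expf_neq0.
have := moves_tboost Uq cs'.
suff -> : proj (tboost tau^-1 (- q / tau) (oone R, 0, q *: oone R)) =
    proj (oone R, 0, 0) by [].
rewrite -(projZ (oone R) 0 0 tau0) !scaler0; congr proj.
rewrite /tboost !scalerA -!scalerDl; congr (_, _, _).
  congr (_ *: _); have -> : tau^-1 + - q / tau * q = (1 - q ^+ 2) / tau by field.
  by rewrite -tau2 expr2 mulfK.
by have -> : - q / tau + tau^-1 * q = 0 :> R; [field | rewrite scale0r].
Qed.

Lemma moves_base t : inU t -> moves (proj t) (proj (oone R, 0, 0)).
Proof.
move=> /[dup] Ut /inU_cemb[[] [[u v] [d tE]]].
  by rewrite tE; exact: moves_base1.
(* A quarter turn sends (u, 1, v) to (-1, u, v), a representative of [1, -u, -v] up to the real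
   factor -1. *)
have cs : 0 ^+ 2 + 1 ^+ 2 = 1 :> R by rewrite expr0n expr1n add0r.
apply: (moves_trans (moves_trot Ut cs)); rewrite tE.
have -> : proj (trot 0 1 (cemb false (u, v))) = proj (oone R, - u, - v).
  have n0 : -1 != 0 :> R by rewrite oppr_eq0 oner_eq0.
  rewrite -(projZ (oone R) (- u) (- v) n0); congr proj.
  by rewrite /trot /= !scale0r add0r addr0 scale1r !scaleN1r !opprK.
apply: moves_base1; move: d; rewrite /cdom /=.
by rewrite -!(scaleN1r (_ : oct R)) !onorm2Z sqrrN expr1n !mul1r.
Qed.

End Symmetries.

(** * From symmetries to isometries *)

Section Isometries.
Variable R : realType.
Local Notation E := (coord R).
Implicit Types (t : triple R) (P Q : hermitian R) (x y w : E) (i j : bool).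
Implicit Types (L : hermitian R -> hermitian R).

Definition proj_lift L t : triple R := let P := L (proj t) in
  if h1 P == 0 then cemb false (hchart false P) else cemb true (hchart true P).

Lemma hchart_is_proj j P : is_proj P -> hdiag j P != 0 ->
  cdom (hchart j P) /\ proj (cemb j (hchart j P)) = P.
Proof.
move=> [t Ut ->] n0.
by apply: proj_cemb_hchart => //; [exact: tnorm_gt0 | exact: tassoc_inU].
Qed.

Lemma proj_lift_spec L t : hsymmetry L -> inU t ->
  inU (proj_lift L t) /\ proj (proj_lift L t) = L (proj t).
Proof.
move=> sL Ut; have pP : is_proj (L (proj t)) by apply: hsymmetry_proj => //; exists t.
rewrite /proj_lift; case: eqP => [P0|/eqP P0].
  have [||d e] := @hchart_is_proj false (L (proj t)) => //; last first.
    by split=> //; exact: cemb_inU.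
  case: pP P0 => t' Ut' ->; exact/proj_hdiag/tnorm_gt0.
by have [//|//|d e] := @hchart_is_proj true (L (proj t)); split=> //; exact: cemb_inU.
Qed.

Lemma hdiag_cemb j x : cdom x -> hdiag j (proj (cemb j x)) != 0.
Proof.
move=> dx; have k0 := tnorm_gt0 (cemb_inU j dx); case: j k0 => k0;
by apply: mulf_neq0; [rewrite invr_eq0; exact: lt0r_neq0 | rewrite onorm2_1 oner_neq0].
Qed.

Lemma locdomE L i j x : hsymmetry L ->
  locdom (proj_lift L) i j x <-> cdom x /\ hdiag j (L (proj (cemb i x))) != 0.
Proof.
move=> sL; split=> -[dx].
  have [_ lE] := proj_lift_spec sL (cemb_inU i dx).
  by move=> [y [dy /Msim_proj]]; rewrite lE => <-; split=> //; exact: hdiag_cemb.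
move=> n0; have Ux := cemb_inU i dx; have [Ul lE] := proj_lift_spec sL Ux; split=> //.
have [|d e] := hchart_is_proj _ n0; first by apply: hsymmetry_proj => //; exists (cemb i x).
exists (hchart j (L (proj (cemb i x)))); split=> //.
by apply: proj_Msim => //; [exact: cemb_inU | rewrite e lE].
Qed.

(** Chart coordinates are determined by the projector, so every local expression of the map is the
    rational one. *)
Lemma locdom_unique L i j x y : hsymmetry L -> cdom x -> cdom y ->
  Msim (cemb j y) (proj_lift L (cemb i x)) -> y = hchart j (L (proj (cemb i x))).
Proof.
move=> sL dx dy /Msim_proj; have [_ ->] := proj_lift_spec sL (cemb_inU i dx).
by move=> <-; rewrite hchartK.
Qed.

Ltac rat := repeat first
  [ done | assumption | apply: rational_cst | apply: rational_add
  | apply: rational_opp | apply: rational_mul | apply: rational_ore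
  | apply: rational_onorm2 | apply: rational_fst | apply: rational_snd
  | apply: rational_oadd | apply: rational_oscale | apply: rational_omul
  | apply: rational_oconj | apply: rational_ocst].

Lemma rational_cdom (D : set E) : rational D (fun x => 1 + onorm2 x.1 - onorm2 x.2).
Proof. by rat. Qed.

Lemma rational_proj (D : set E) i : D `<=` @cdom R ->
  rational_herm D (fun x => proj (cemb i x)).
Proof.
move=> DC; have rk : rational D (fun x => (tnorm (cemb i x))^-1).
  have -> : (fun x => (tnorm (cemb i x))^-1) =
      (fun x => (1 + onorm2 x.1 - onorm2 x.2)^-1).
    by apply/funext => x; rewrite tnorm_cemb.
  apply: rational_inv; last exact: rational_cdom.
  by move=> x /DC/lt0r_neq0.
by case: i rk => rk; split; split; rat.
Qed.

(** By [locdomE] the domain is cut out by positivity of one rational function and non-vanishing of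
    another. *)
Lemma locdom_open L i j : hsymmetry L -> open (locdom (proj_lift L) i j).
Proof.
move=> sL; rewrite openE => x /(locdomE i j _ sL)[dx hx].
have rP := hsymmetry_rational sL (@rational_proj (@cdom R) i (fun=> id)).
have rh : rational (@cdom R) (fun y => hdiag j (L (proj (cemb i y)))).
  by case: rP => -[r1 r2 _] _; case: j {hx}.
have c1 := rational_continuous (rational_cdom setT) (I : setT x).
have c2 := rational_continuous rh dx.
rewrite /interior; near=> y; apply/(locdomE i j y sL); split; near: y.
- exact: (cvgr_gt _ c1).
- exact: (cvgr_neq0 _ c2).
Unshelve. all: by end_near. Qed.

Lemma hchart_rational (D : set E) j Psi : rational_herm D Psi ->
  (forall x, D x -> hdiag j (Psi x) != 0) ->
  rational_vec D (fun x => hchart j (Psi x)).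
Proof.
move=> [[r1 r2 _] [r12 r13 r23]]; case: j => n0; apply: rational_vec_pair;
by rat; apply: rational_inv.
Qed.

Lemma smooth_proj_lift L : hsymmetry L -> smooth_map (proj_lift L).
Proof.
move=> sL; split.
  split=> [t /(proj_lift_spec sL)[]//|t s Ut Us /Msim_proj e].
  have [Ut' et] := proj_lift_spec sL Ut; have [Us' es] := proj_lift_spec sL Us.
  by apply: proj_Msim => //; rewrite et es e.
move=> i j; have o := @locdom_open L i j sL; split=> //.
exists (fun x => hchart j (L (proj (cemb i x)))); split.
  move=> x [dx [y [dy s]]]; by rewrite -(locdom_unique sL dx dy s).
apply: rational_vec_smooth => //; apply: hchart_rational.
  by apply: (hsymmetry_rational sL); apply: rational_proj => x [].
by move=> x /(locdomE i j _ sL)[].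
Qed.

Lemma rational_gmet x : rational setT (fun w => gmet x w).
Proof.
case: x => u v.
have -> : gmet (u, v) = (fun w => (onorm2 w.1 * (1 - onorm2 v) - onorm2 w.2 * (1 + onorm2 u)
    + 2 * ore (omul (omul u (oconj v)) (omul w.2 (oconj w.1))))
    * (1 + onorm2 u - onorm2 v) ^- 2).
  by apply/funext => -[].
by rat.
Qed.

Lemma gmetZ k x w : gmet x (k *: w) = k ^+ 2 * gmet x w.
Proof.
case: x w => u v [a b]; rewrite /gmet /=.
rewrite !onorm2Z oconjZ !(omulZl, omulZr) !oreZ; ring.
Qed.

(** Eliminates the chordal factor [d] between two instances of [hform_chord] without dividing by it,
    since it vanishes along null directions. *)
Lemma cross_mul_eq (k d a b a' b' g g' : R) : k != 0 ->
  b * d = a * (k * g) -> b' * d = a' * g' -> a * g * b' = b * a' * (k^-1 * g').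
Proof.
move=> k0 e1 e2; apply: (mulfI k0).
transitivity (b' * (a * (k * g))); first by ring.
by rewrite -e1; transitivity (b * (a' * g')); [rewrite -e2; ring | field].
Qed.

(** The symmetry preserves the chordal quantity 1 - <P, Q>. Comparing [hform_chord] for the
    displacement h w at [x] with the image displacement at [f x], dividing by h^2 and letting h tend
    to 0 compares the metrics. *)
Lemma proj_lift_preserves L : hsymmetry L -> preserves_metric (proj_lift L).
Proof.
move=> sL i j f fP x lx w; have o := @locdom_open L i j sL.
(* The local expression [f] is arbitrary, but on the open domain it is forced to be the rational map
   [f0], which makes it differentiable there. *)
pose f0 := fun y => hchart j (L (proj (cemb i y))).
have ff0 y : locdom (proj_lift L) i j y -> f y = f0 y.
  by move=> ly; have [d s] := fP y ly; exact: locdom_unique sL ly.1 d s.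
have projf y : locdom (proj_lift L) i j y -> proj (cemb j (f y)) = L (proj (cemb i y)).
  move=> ly; have [d /Msim_proj ->] := fP y ly.
  by have [] := proj_lift_spec sL (cemb_inU i ly.1).
have smf : rational_vec (locdom (proj_lift L) i j) f0.
  apply: hchart_rational; last by move=> y /(locdomE i j _ sL)[].
  by apply: (hsymmetry_rational sL); apply: rational_proj => y [].
have nx : \forall y \near x, locdom (proj_lift L) i j y by exact: open_nbhs_nbhs.
have nff0 : \forall y \near x, f y = f0 y by near=> y; apply: ff0; near: y.
have [f' _ df] := rational_vec_derive w smf; have [dfx _] := df x lx.
have dfw : derivable f x w.
  by apply: near_eq_derivable dfx; near=> y; apply/esym; near: y.
pose c (y : E) := 1 + onorm2 y.1 - onorm2 y.2.
have cc y : {for y, continuous c}.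
  by apply: rational_continuous (rational_cdom setT) _.
have cf : {for x, continuous f}.
  change (f y @[y --> x] --> f x); rewrite (ff0 x lx).
  apply: cvg_trans (rational_vec_continuous smf lx); apply: near_eq_cvg.
  by near=> y; apply/esym; near: y.
have line : h *: w + x @[h --> 0^'] --> x.
  rewrite -[X in _ --> X]add0r -(scale0r w); apply: cvgD; last exact: cvg_cst.
  by apply: cvgZr_tmp; exact: cvg_within.
have lim1 : c x * gmet x w * c (f (h *: w + x)) @[h --> 0^'] -->
    c x * gmet x w * c (f x).
  apply: cvgM; first exact: cvg_cst.
  by apply: (continuous_cvg _ (cc (f x))); apply: (continuous_cvg _ cf).
have lim2 : c (h *: w + x) * c (f x) * gmet (f x) (h^-1 *: (f (h *: w + x) - f x))
    @[h --> 0^'] --> c x * c (f x) * gmet (f x) ('D_w f x).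
  apply: cvgM; first by apply: cvgM; [exact: (continuous_cvg _ (cc x)) | exact: cvg_cst].
  have cg : {for 'D_w f x, continuous (gmet (f x))}.
    exact: rational_continuous (rational_gmet (f x)) I.
  exact: (continuous_cvg _ cg dfw).
have nl : \forall h \near 0^', locdom (proj_lift L) i j (h *: w + x) by exact: (line _ nx).
have eqn : \forall h \near 0^', c x * gmet x w * c (f (h *: w + x)) =
    c (h *: w + x) * c (f x) * gmet (f x) (h^-1 *: (f (h *: w + x) - f x)).
  near=> h; have h0 : h != 0 by near: h; exact: nbhs_dnbhs_neq.
  have lh : locdom (proj_lift L) i j (h *: w + x) by near: h.
  have [dx _] := lx; have [dh _] := lh.
  have [dfx0 _] := fP _ lx; have [dfh _] := fP _ lh.
  pose y := h *: w + x; rewrite -/y in lh dh dfh *.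
  have e1 : c y * (1 - hform (proj (cemb i x)) (proj (cemb i y))) =
      c x * gmet x (h *: w).
    by rewrite /y [h *: w + x]addrC; apply: hform_chord => //; rewrite addrC.
  have e2 : c (f y) * (1 - hform (proj (cemb i x)) (proj (cemb i y))) =
      c (f x) * gmet (f x) (f y - f x).
    rewrite -(hsymmetry_form sL) -!projf //.
    by have := @hform_chord R j (f x) (f y - f x); rewrite [f x + _]addrC subrK; apply.
  have h2 : h ^+ 2 != 0 by rewrite expf_neq0.
  move: e1 e2; rewrite !gmetZ exprVn; apply: (cross_mul_eq h2).
(* Both sides of [eqn] converge and limits are unique; the positive factors [c x] and [c (f x)]
   cancel afterwards. *)
have e : c x * gmet x w * c (f x) = c x * c (f x) * gmet (f x) ('D_w f x).
  rewrite -(cvg_lim (@norm_hausdorff _ _) lim1).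
  apply: cvg_lim; first exact: norm_hausdorff.
  by apply: cvg_trans lim2; apply: near_eq_cvg; near=> h; apply/esym; near: h.
have [dx _] := lx; have [dfx0 _] := fP _ lx.
apply: (mulfI (lt0r_neq0 dx)); apply: (mulfI (lt0r_neq0 dfx0)).
rewrite -/(c x) -/(c (f x)); rewrite mulrA [c (f x) * _]mulrC -e; ring.
Unshelve. all: by end_near. Qed.

Lemma proj_lift_isometry L L' : hsymmetry L -> hsymmetry L' ->
  (forall P, is_proj P -> L' (L P) = P) -> (forall P, is_proj P -> L (L' P) = P) ->
  OP11_isometry (proj_lift L).
Proof.
move=> sL sL' K K'; split; first exact: smooth_proj_lift.
split; first exact: proj_lift_preserves.
exists (proj_lift L'); split; first exact: smooth_proj_lift.
have cancel M M' : hsymmetry M -> hsymmetry M' -> (forall P, is_proj P -> M' (M P) = P) ->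
    forall t, inU t -> Msim (proj_lift M' (proj_lift M t)) t.
  move=> sM sM' KM t Ut; have [U1 e1] := proj_lift_spec sM Ut.
  have [U2 e2] := proj_lift_spec sM' U1.
  by apply: proj_Msim => //; rewrite e2 e1 KM //; exists t.
by split; apply: cancel.
Qed.

End Isometries.

(* Homogeneity: the isometry group of (OP^(1,1), g) acts transitively. *)
Theorem theorem7p3 (R : realType) (p q : triple R) :
  inU p -> inU q -> exists F : triple R -> triple R, OP11_isometry F /\ Msim (F p) q.
Proof.
move=> Up Uq.
(* Both points move to [1, 0, 0], and the second move is inverted. *)
have [L [L' [sL sL' K K' e]]] : moves (proj p) (proj q).
  apply: (moves_trans (moves_base Up)); apply: moves_sym; first by exists q.
  exact: moves_base.
exists (proj_lift L); split; first exact: proj_lift_isometry sL sL' K K'.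
by have [Ul el] := proj_lift_spec sL Up; apply: proj_Msim => //; rewrite el.
Qed.
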